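(* None of the following ten properties of a variety $\mathcal V$ is Maltsev definable, i.e., for each of them, the class of all varieties having the property is not definable by a Maltsev condition. (Each property is required to hold for every $\mathbf A\in\mathcal V$ and all $x,y,z,y',z'\in\mathrm{Con}(\mathbf A)$.) (1) $[x,y]=[y,x]$. (2) $[x+y,z]=[x,z]+[y,z]$. (3) $[x,y+z]=[x,y]+[x,z]$. (4) $[x,y]=[x,y']\Longrightarrow[x,y]=[x,y+y']$. (5) Given $x$, there exists a largest $y\in\mathrm{Con}(\mathbf A)$ such that $[x,y]=0$. (6) Given $x,z$, there exists a largest $y\in\mathrm{Con}(\mathbf A)$ such that $C(x,y;z)$. (7) $C(x,y;z)\Longleftrightarrow C(y,x;z)$. (8) $C(x,y;z)\Longleftrightarrow[x,y]\leq z$. (9) $C(x,y;z)$ and $z\leq z'$ imply $C(x,y;z')$. (10) $C(x,y;z)$ and $z\leq z'\leq x\cap y$ imply $C(x,y;z')$.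
   Context: A variety is an equationally defined class of algebras of a fixed (arbitrary) signature. $\mathrm{Con}(\mathbf A)$ is the congruence lattice of $\mathbf A$, with meet $\cap$, join $+$, and least element $0$ (the equality relation). For $\alpha,\beta\in\mathrm{Con}(\mathbf A)$, an $\alpha,\beta$-matrix is a matrix $\begin{bmatrix}p&q\\ r&s\end{bmatrix}=\begin{bmatrix}t(\mathbf a,\mathbf u)&t(\mathbf a,\mathbf v)\\ t(\mathbf b,\mathbf u)&t(\mathbf b,\mathbf v)\end{bmatrix}$, where $t$ is an $(m+n)$-ary term operation of $\mathbf A$, $(a_i,b_i)\in\alpha$ for all $i$ and $(u_j,v_j)\in\beta$ for all $j$. For $\delta\in\mathrm{Con}(\mathbf A)$, the relation $C(\alpha,\beta;\delta)$ holds if for every $\alpha,\beta$-matrix $\begin{bmatrix}p&q\\ r&s\end{bmatrix}$, $(p,q)\in\delta$ implies $(r,s)\in\delta$. The commutator $[\alpha,\beta]$ is the least congruence $\delta$ such that $C(\alpha,\beta;\delta)$ holds. A strong Maltsev condition is a positive primitive sentence in the language of clones, i.e., a sentence $\sigma$ asserting the existence of finitely many clone elements (of prescribed arities) satisfying finitely many prescribed identities; a variety satisfies $\sigma$ if its clone does (i.e., it has terms of the prescribed arities satisfying the prescribed identities). A Maltsev condition is a sequence $\Sigma=(\sigma_n)_{n\in\omega}$ of successively weaker strong Maltsev conditions ($\sigma_n\vdash\sigma_{n+1}$ for all $n$); a variety satisfies $\Sigma$ if it satisfies $\sigma_n$ for some $n$. A class of varieties is definable by a Maltsev condition (Maltsev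 definable) if it is exactly the class of all varieties satisfying some Maltsev condition $\Sigma$. *)

(* Defs.v *)
From mathcomp Require Import all_boot boolp.

Set Implicit Arguments.
Unset Strict Implicit.
Unset Printing Implicit Defensive.

(** * Algebras, terms, varieties *)

Record signature := Signature {
  op :> Type;
  arity : op -> nat
}.

Record algebra (S : signature) := Algebra {
  carrier :> Type;
  interp : forall f : S, ('I_(arity f) -> carrier) -> carrier;
  carrier_inhabited : inhabited carrier
}.

Inductive term (S : signature) (X : Type) :=
| Var (x : X)
| App (f : S) (args : 'I_(arity f) -> term S X).

Arguments Var {S X} x.
Arguments App {S X} f args.

Fixpoint eval (S : signature) (A : algebra S) (X : Type) (env : X -> A)
    (t : term S X) : A :=
  match t with
  | Var x => env x
  | App f args => interp (fun i => eval env (args i))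
  end.

Definition identity (S : signature) := (term S nat * term S nat)%type.

Definition holds (S : signature) (A : algebra S) (e : identity S) : Prop :=
  forall env : nat -> A, eval env e.1 = eval env e.2.

(** A variety is given by its signature and a (possibly infinite) set of
    defining identities; as a class of algebras it consists of the [A] such
    that [in_variety V A]. *)
Record variety := Variety {
  sig :> signature;
  axioms : identity sig -> Prop
}.

Definition in_variety (V : variety) (A : algebra V) : Prop :=
  forall e, axioms e -> holds A e.

(** * Maltsev conditions *)

(** The sentence "there are clone elements [f_0], ..., [f_(k-1)], with [f_i] of
    arity [smc_arity i], satisfying the identities [smc_identity j]". *)
Record strong_maltsev := StrongMaltsev {
  smc_size : nat;
  smc_arity : 'I_smc_size -> nat;
  smc_nb_identities : nat;
  smc_identity : 'I_smc_nb_identities -> identity (Signature smc_arity)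
}.

Definition smc_sig (s : strong_maltsev) : signature :=
  Signature (smc_arity (s := s)).

(** [A] viewed as an algebra of signature [S'], the operation [f] of [S'] being
    the term operation of [A] given by [t f]. *)
Definition term_reduct (S S' : signature)
    (t : forall f : S', term S 'I_(arity f)) (A : algebra S) : algebra S' :=
  @Algebra S' A (fun f args => eval args (t f)) (carrier_inhabited A).

Definition satisfies_strong (V : variety) (s : strong_maltsev) : Prop :=
  exists t : forall f : smc_sig s, term V 'I_(arity f),
    forall A : algebra V, in_variety A ->
      forall j, holds (term_reduct t A) (smc_identity (s := s) j).

(** Up to isomorphism, clones are exactly the clones of varieties, so entailment
    between sentences about clones can be tested on varieties. *)
Definition entails (s s' : strong_maltsev) : Prop :=
  forall V : variety, satisfies_strong V s -> satisfies_strong V s'.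

Record maltsev_condition := MaltsevCondition {
  mc_seq :> nat -> strong_maltsev;
  mc_weaker : forall n, entails (mc_seq n) (mc_seq n.+1)
}.

Definition satisfies (V : variety) (M : maltsev_condition) : Prop :=
  exists n, satisfies_strong V (M n).

Definition Maltsev_definable (P : variety -> Prop) : Prop :=
  exists M : maltsev_condition, forall V : variety, P V <-> satisfies V M.

(** * Congruences *)

Record Con (S : signature) (A : algebra S) := Congruence {
  con_rel :> A -> A -> Prop;
  con_refl : forall a, con_rel a a;
  con_sym : forall a b, con_rel a b -> con_rel b a;
  con_trans : forall a b c, con_rel a b -> con_rel b c -> con_rel a c;
  con_op : forall (f : S) (a b : 'I_(arity f) -> A),
    (forall i, con_rel (a i) (b i)) -> con_rel (interp a) (interp b)
}.

Declare Scope con_scope.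
Delimit Scope con_scope with con.
Bind Scope con_scope with Con.

Section Congruences.
Variables (S : signature) (A : algebra S).
Implicit Types x y z : Con A.

Definition con_le x y : Prop := forall a b, x a b -> y a b.

Lemma con_ext x y : con_le x y -> con_le y x -> x = y.
Proof.
case: x y => [r r1 r2 r3 r4] [s s1 s2 s3 s4] rs sr.
have E : r = s.
  by apply/funext => a; apply/funext => b; apply/propext; split; [apply: rs|apply: sr].
by subst s; congr Congruence; apply: Prop_irrelevance.
Qed.

Lemma con0_op (f : S) (a b : 'I_(arity f) -> A) :
  (forall i, a i = b i) -> interp a = interp b.
Proof. by move=> /funext ->. Qed.

Definition con0 : Con A :=
  @Congruence S A (@eq A) (@erefl A) (@esym A) (@etrans A) con0_op.

Definition con_inf (P : Con A -> Prop) : Con A.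
Proof.
refine (@Congruence S A (fun a b => forall z, P z -> z a b) _ _ _ _).
- by move=> a z _; apply: con_refl.
- by move=> a b ab z Pz; apply: con_sym; apply: ab.
- by move=> a b c ab bc z Pz; apply: con_trans (ab z Pz) (bc z Pz).
- by move=> f a b ab z Pz; apply: con_op => i; apply: ab.
Defined.

Definition con_meet x y : Con A.
Proof.
refine (@Congruence S A (fun a b => x a b /\ y a b) _ _ _ _).
- by move=> a; split; apply: con_refl.
- by move=> a b [? ?]; split; apply: con_sym.
- by move=> a b c [? ?] [? ?]; split; apply: (con_trans (b := b)).
- by move=> f a b ab; split; apply: con_op => i; case: (ab i).
Defined.

Definition con_join x y : Con A :=
  con_inf (fun z => con_le x z /\ con_le y z).

Lemma con_joinP x y z : con_le (con_join x y) z <-> con_le x z /\ con_le y z.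
Proof.
split=> [h|h a b]; last exact.
by split=> a b ab; apply: h => w [xw yw]; [apply: xw | apply: yw].
Qed.

(** * Centrality and the commutator *)

Definition cat_args (m n : nat) (a : 'I_m -> A) (u : 'I_n -> A) :
    'I_(m + n) -> A :=
  fun k => match split k with inl i => a i | inr j => u j end.

(** The matrix with rows [p q] and [r s] is an [x],[y]-matrix. *)
Definition is_matrix x y (p q r s : A) : Prop :=
  exists (m n : nat) (t : term S 'I_(m + n))
         (a b : 'I_m -> A) (u v : 'I_n -> A),
    [/\ forall i, x (a i) (b i), forall j, y (u j) (v j),
        p = eval (cat_args a u) t /\ q = eval (cat_args a v) t &
        r = eval (cat_args b u) t /\ s = eval (cat_args b v) t].

(** The relation C(x, y; z). *)
Definition centralizes x y z : Prop :=
  forall p q r s : A, is_matrix x y p q r s -> z p q -> z r s.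

Definition commutator x y : Con A := con_inf (centralizes x y).

(** C(x, y; -) is closed under intersections, so that the commutator is indeed
    the least [z] with C(x, y; z). *)
Lemma commutator_least x y :
  centralizes x y (commutator x y) /\
  forall z, centralizes x y z -> con_le (commutator x y) z.
Proof.
split=> [p q r s M pq z Cz|z Cz a b]; last exact.
exact: Cz M (pq z Cz).
Qed.

Definition is_largest (P : Con A -> Prop) y : Prop :=
  P y /\ forall y', P y' -> con_le y' y.

End Congruences.

Arguments con0 {S A}.

Notation "0" := con0 : con_scope.
Notation "x <= y" := (con_le x y) : con_scope.
Notation "x + y" := (con_join x y) : con_scope.
Notation "x :&: y" := (con_meet x y) : con_scope.

(* Main.v *)
Require Import Defs.
From mathcomp Require Import all_boot boolp.

(** Every Maltsev condition satisfied by the variety of sets is satisfied by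
    every variety, because the terms of the empty signature are variables. In
    the variety of sets C(x, y; z) always holds, so that each of the ten
    properties does too. Hence it is enough to have, for each property, one
    variety where it fails, and the variety of all groupoids is such a variety
    for all ten of them, as a single twelve-element groupoid shows. *)

Set Implicit Arguments.
Unset Strict Implicit.
Unset Printing Implicit Defensive.

(** * The variety of sets *)

Definition empty_sig : signature := @Signature void (fun=> 0).

Definition Sets : variety := @Variety empty_sig (fun=> False).

Definition set_algebra (T : Type) (inh : inhabited T) : algebra Sets :=
  @Algebra empty_sig T (fun f => match f with end) inh.

Definition lift_term (S : signature) (X : Type) (t : term empty_sig X) :
    term S X :=
  match t with
  | Var x => Var x
  | App f _ => match f with end
  end.

Lemma satisfies_strong_Sets (V : variety) (s : strong_maltsev) :
  satisfies_strong Sets s -> satisfies_strong V s.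
Proof.
case=> t tP; exists (fun f => lift_term V (t f)) => A _ j.
(* Both sides interpret each symbol by the same projection of the carrier, so the identities
   transfer from the bare set underlying [A]. *)
have -> : term_reduct (S' := smc_sig s) (fun f => lift_term V (t f)) A =
          term_reduct t (set_algebra (carrier_inhabited A)).
  rewrite /term_reduct; congr Algebra.
  apply: functional_extensionality_dep => f; apply/funext => a.
  by case: (t f) => [|[]].
exact: tP.
Qed.

Lemma not_Maltsev_definable (P : variety -> Prop) (V : variety) :
  P Sets -> ~ P V -> ~ Maltsev_definable P.
Proof.
move=> PSets nPV [M MP]; apply: nPV.
have [n sat_n] := (MP Sets).1 PSets.
by apply/MP; exists n; apply: satisfies_strong_Sets.
Qed.

(** * Matrices and centrality in an arbitrary algebra *)

Section Congruence_lattice.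
Variables (S : signature) (A : algebra S).
Implicit Types x y z w : Con A.

Lemma con_le_joinl x y : con_le x (con_join x y).
Proof. by move=> a b xab z [xz _]; apply: xz. Qed.

Lemma con_le_joinr x y : con_le y (con_join x y).
Proof. by move=> a b yab z [_ yz]; apply: yz. Qed.

Lemma con_le0 x : con_le con0 x.
Proof. by move=> a b ->; apply: con_refl. Qed.

Lemma is_matrix_mono x x' y y' p q r s :
  con_le x x' -> con_le y y' ->
  is_matrix x y p q r s -> is_matrix x' y' p q r s.
Proof.
move=> xx' yy' [m [n [t [a [b [u [v [xab yuv pq rs]]]]]]]].
by exists m, n, t, a, b, u, v; split=> // i; [apply: xx' | apply: yy'].
Qed.

Lemma centralizes_mono x x' y y' z : con_le x x' -> con_le y y' ->
  centralizes x' y' z -> centralizes x y z.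
Proof. by move=> xx' yy' C p q r s M; apply: C; apply: is_matrix_mono M. Qed.

(** Replaces the vanishing of a commutator by a centrality relation, which in a finite algebra is a
    case check. *)
Lemma commutator_eq0 x y : commutator x y = con0 <-> centralizes x y con0.
Proof.
have [C least] := commutator_least x y; split=> [<- //|/least le0].
by apply: con_ext => //; apply: con_le0.
Qed.

(* The [x],[y]-matrices form the subalgebra of A^4 generated by the two
   families of degenerate matrices. *)
Lemma is_matrix_ind x y (R : A -> A -> A -> A -> Prop) :
  (forall a b, x a b -> R a a b b) ->
  (forall u v, y u v -> R u v u v) ->
  (forall (f : S) (p q r s : 'I_(arity f) -> A),
     (forall i, R (p i) (q i) (r i) (s i)) ->
     R (interp p) (interp q) (interp r) (interp s)) ->
  forall p q r s, is_matrix x y p q r s -> R p q r s.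
Proof.
move=> Rx Ry Rop p q r s [m [n [t [a [b [u [v [xab yuv [-> ->] [-> ->]]]]]]]]].
elim: t => [k|f args IH] /=; last by apply: Rop => i; apply: IH.
by rewrite /cat_args; case: split => i; [apply: Rx | apply: Ry].
Qed.

End Congruence_lattice.

(** Without operations every matrix is degenerate: its rows are constant or equal to each other. *)
Lemma Sets_centralizes (A : algebra Sets) (x y z : Con A) : centralizes x y z.
Proof.
move=> p q r s M.
apply: (is_matrix_ind (R := fun p q r s => z p q -> z r s)) M => // a b _ _.
exact: con_refl.
Qed.

Lemma Sets_commutator (A : algebra Sets) (x y : Con A) :
  commutator x y = con0.
Proof. by apply/commutator_eq0/Sets_centralizes. Qed.

(** * A groupoid *)

Definition groupoid_sig : signature := @Signature unit (fun=> 2).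

Definition Groupoids : variety := @Variety groupoid_sig (fun=> False).

Inductive elt := a0 | a1 | a2 | u0 | u1 | u2 | vo | vp | vq | vr | vs | vt.

(* All products equal [vo], except those given by the table
         u0  u1  u2
     a1  vp  vq  vp
     a2  vr  vs  vt
   The rows a0 and a1 witness the failure of C(cw, cy; 0) and the rows a1 and
   a2 those of C(cx, cy; cb) and C(cx, cy + cy'; 0), for the congruences
   below. *)
Definition mul (d e : elt) : elt :=
  match d, e with
  | a1, u0 => vp | a1, u1 => vq | a1, u2 => vp
  | a2, u0 => vr | a2, u1 => vs | a2, u2 => vt
  | _, _ => vo
  end.

Definition G : algebra Groupoids :=
  @Algebra groupoid_sig elt (fun _ args => mul (args ord0) (args ord_max))
    (inhabits vo).

Definition is_value (d : elt) : bool :=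
  match d with vo | vp | vq | vr | vs | vt => true | _ => false end.

Lemma mul_value d e : is_value (mul d e).
Proof. by case: d; case: e. Qed.

Lemma mul_valuel d e : is_value d -> mul d e = vo.
Proof. by case: d. Qed.

Lemma mul_valuer d e : is_value e -> mul d e = vo.
Proof. by case: e; case: d. Qed.

(** With [h] choosing class representatives, compatibility becomes a check over the 144 pairs of
    elements instead of over pairs of related pairs. *)
Lemma ker_op (h : elt -> elt) :
  (forall d e, h (mul d e) = h (mul (h d) (h e))) ->
  forall (f : groupoid_sig) (d e : 'I_(arity f) -> G),
    (forall i, h (d i) = h (e i)) -> h (interp d) = h (interp e).
Proof.
by move=> hM [] d e de /=; rewrite hM (hM (e _)) !de.
Qed.

Definition ker (h : elt -> elt)
    (hM : forall d e, h (mul d e) = h (mul (h d) (h e))) : Con G :=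
  @Congruence groupoid_sig G (fun d e => h d = h e) (fun=> erefl)
    (fun _ _ => @esym _ _ _) (fun _ _ _ => @etrans _ _ _ _) (ker_op hM).

(* Products of values being constant, only the matrices of depth at most one
   matter. *)
Lemma G_centralizes (x y z : Con G) :
  (forall a b, x a b -> forall u v, y u v ->
     (z (mul a u) (mul a v) -> z (mul b u) (mul b v)) /\
     (z (mul u a) (mul v a) -> z (mul u b) (mul v b))) ->
  centralizes x y z.
Proof.
move=> xyz.
(* The three shapes of a matrix: constant rows, equal rows, or all entries values with the wanted
   implication. *)
pose R (p q r s : G) := [\/ [/\ p = q, r = s & x p r], [/\ p = r, q = s & y p q] |
  [/\ is_value p && is_value q, is_value r && is_value s & z p q -> z r s]].
suff sub p q r s : is_matrix x y p q r s -> R p q r s.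
  by move=> p q r s /sub [[-> -> _ _]|[-> -> _]|[]] //; apply: con_refl.
apply: is_matrix_ind => {p q r s} [a b xab|u v yuv|[] P Q V W H].
- by apply: Or31.
- by apply: Or32.
rewrite /=.
have cong (w : Con G) c d e e' : w c d -> w e e' -> w (mul c e) (mul d e').
  move=> wcd wee'.
  have := @con_op _ _ w tt (fun i => if i == ord0 then c else e)
    (fun i => if i == ord0 then d else e').
  by apply=> i; case: ifP.
(* A factor made of values gives the constant matrix [vo], and two factors of the same degenerate
   shape keep it. Factors of different degenerate shapes are handled by [xyz], in either order. *)
have [[-> -> x1]|[-> -> y1]|[/andP[v1 v2] /andP[v3 v4] _]] := H ord0; last first.
- by rewrite !mul_valuel //; apply: Or31; split=> //; apply: con_refl.
- have [[-> -> x2]|[-> -> y2]|[/andP[v1 v2] /andP[v3 v4] _]] := H ord_max.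
  + by apply: Or33; rewrite !mul_value; split=> //; apply: (xyz _ _ x2 _ _ y1).2.
  + by apply: Or32; split=> //; apply: cong.
  + by rewrite !mul_valuer //; apply: Or31; split=> //; apply: con_refl.
have [[-> -> x2]|[-> -> y2]|[/andP[v1 v2] /andP[v3 v4] _]] := H ord_max.
- by apply: Or31; split=> //; apply: cong.
- by apply: Or33; rewrite !mul_value; split=> //; apply: (xyz _ _ x1 _ _ y2).1.
- by rewrite !mul_valuer //; apply: Or31; split=> //; apply: con_refl.
Qed.

Lemma mul_matrix (x y : Con G) a b u v : x a b -> y u v ->
  is_matrix x y (mul a u) (mul a v) (mul b u) (mul b v).
Proof.
move=> xab yuv.
exists 1, 1, (@App groupoid_sig _ tt Var), (fun=> a), (fun=> b), (fun=> u),
  (fun=> v).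
by split=> //; rewrite /= /cat_args;
  case: (@splitP 1 1 ord0) => // ? _; case: (@splitP 1 1 ord_max) => // -[[]].
Qed.

(** Each map picks class representatives. The congruences of [hy], [hy'], [hw] and [hb] are
    generated by ([u0], [u1]), ([u1], [u2]), ([a0], [a1]) and ([vp], [vq]). That of [hx] is
    generated by ([a1], [a2]) and ([vp], [vq]); the second pair puts [cb] below the meet of [cx] and
    [cy], as property (10) requires. *)
Definition hx d :=
  match d with a2 => a1 | vq | vr | vs | vt => vp | _ => d end.
Definition hy d :=
  match d with u1 => u0 | vq => vp | vs => vr | _ => d end.
Definition hy' d :=
  match d with u2 => u1 | vq => vp | vt => vs | _ => d end.
Definition hw d :=
  match d with a1 => a0 | vp | vq => vo | _ => d end.
Definition hb d :=
  match d with vq => vp | _ => d end.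

Definition cx : Con G := @ker hx ltac:(by case; case).
Definition cy : Con G := @ker hy ltac:(by case; case).
Definition cy' : Con G := @ker hy' ltac:(by case; case).
Definition cw : Con G := @ker hw ltac:(by case; case).
Definition cb : Con G := @ker hb ltac:(by case; case).

(** In rows [a1] and [a2], the entries of columns [u0] and [u1] differ, so the premise of centrality
    fails there. The same goes for columns [u1] and [u2] in the next lemma. *)
Lemma centralizes_xy0 : centralizes cx cy con0.
Proof. by apply: G_centralizes; case; case=> //= _; case; case. Qed.

Lemma centralizes_xy'0 : centralizes cx cy' con0.
Proof. by apply: G_centralizes; case; case=> //= _; case; case. Qed.

Lemma centralizes_yw0 : centralizes cy cw con0.
Proof. by apply: G_centralizes; case; case=> //= _; case; case. Qed.

Lemma centralizes_wyb : centralizes cw cy cb.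
Proof. by apply: G_centralizes; case; case=> //= _; case; case. Qed.

Lemma centralizes_wy_pq z : centralizes cw cy z -> z vp vq.
Proof.
move=> C; apply: C (con_refl z vo).
by apply: (@mul_matrix cw cy a0 a1 u0 u1).
Qed.

Lemma centralizes_xy_rs z : centralizes cx cy z -> z vp vq -> z vr vs.
Proof. by apply; apply: (@mul_matrix cx cy a1 a2 u0 u1). Qed.

(** The join relates [u0] to [u2] through [u1], and these two columns agree in row [a1] but not in
    row [a2]. *)
Lemma not_centralizes_xyy'0 : ~ centralizes cx (con_join cy cy') con0.
Proof.
move=> C; suff : @con0 _ G vr vt by [].
apply: (C vp vp) => //; apply: (@mul_matrix cx _ a1 a2 u0 u2) => //.
by apply: (@con_trans _ _ _ _ (u1 : G));
  [apply: con_le_joinl | apply: con_le_joinr].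
Qed.

Theorem mainTheorem7 :
  (~ Maltsev_definable (fun V : variety =>
    forall A : algebra V, in_variety A -> forall x y : Con A,
      (commutator x y = commutator y x)%con)) /\
  (~ Maltsev_definable (fun V : variety =>
    forall A : algebra V, in_variety A -> forall x y z : Con A,
      (commutator (x + y) z = commutator x z + commutator y z)%con)) /\
  (~ Maltsev_definable (fun V : variety =>
    forall A : algebra V, in_variety A -> forall x y z : Con A,
      (commutator x (y + z) = commutator x y + commutator x z)%con)) /\
  (~ Maltsev_definable (fun V : variety =>
    forall A : algebra V, in_variety A -> forall x y y' : Con A,
      (commutator x y = commutator x y' ->
      commutator x y = commutator x (y + y'))%con)) /\
  (~ Maltsev_definable (fun V : variety =>
    forall A : algebra V, in_variety A -> forall x : Con A,
      (exists y : Con A, is_largest (fun w => commutator x w = 0) y)%con)) /\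
  (~ Maltsev_definable (fun V : variety =>
    forall A : algebra V, in_variety A -> forall x z : Con A,
      (exists y : Con A, is_largest (fun w => centralizes x w z) y)%con)) /\
  (~ Maltsev_definable (fun V : variety =>
    forall A : algebra V, in_variety A -> forall x y z : Con A,
      (centralizes x y z <-> centralizes y x z)%con)) /\
  (~ Maltsev_definable (fun V : variety =>
    forall A : algebra V, in_variety A -> forall x y z : Con A,
      (centralizes x y z <-> commutator x y <= z)%con)) /\
  (~ Maltsev_definable (fun V : variety =>
    forall A : algebra V, in_variety A -> forall x y z z' : Con A,
      (centralizes x y z -> z <= z' -> centralizes x y z')%con)) /\
  (~ Maltsev_definable (fun V : variety =>
    forall A : algebra V, in_variety A -> forall x y z z' : Con A,
      (centralizes x y z -> z <= z' -> z' <= x :&: y ->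
      centralizes x y z')%con)).
Proof.
have inG : in_variety G by [].
have Cb : ~ centralizes cx cy cb by move/centralizes_xy_rs => /(_ erefl).
have n10 : ~ (forall A : algebra Groupoids, in_variety A ->
    forall x y z z' : Con A, (centralizes x y z -> z <= z' -> z' <= x :&: y ->
      centralizes x y z')%con).
  move=> /(_ G inG cx cy con0 cb centralizes_xy0 (@con_le0 _ _ _)) H.
  by apply: Cb; apply: H => -[] [] //=.
have n9 : ~ (forall A : algebra Groupoids, in_variety A ->
    forall x y z z' : Con A, (centralizes x y z -> z <= z' ->
      centralizes x y z')%con).
  by move=> H; apply: n10 => A VA x y z z' C le _; apply: (H A VA x y z).
have n1 : ~ (forall A : algebra Groupoids, in_variety A ->
    forall x y : Con A, commutator x y = commutator y x).
  move=> /(_ G inG cw cy) E.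
  have /commutator_eq0 E0 := centralizes_yw0.
  have := (commutator_least cw cy).1; rewrite E E0.
  by move/centralizes_wy_pq.
have n5 : ~ (forall A : algebra Groupoids, in_variety A -> forall x : Con A,
    exists y : Con A, is_largest (fun w => commutator x w = con0) y).
  move=> /(_ G inG cx) [z [/commutator_eq0 C max]]; apply: not_centralizes_xyy'0.
  apply: centralizes_mono C => //.
  by apply/con_joinP; split; apply: max; apply/commutator_eq0;
    [apply: centralizes_xy0 | apply: centralizes_xy'0].
have n4 : ~ (forall A : algebra Groupoids, in_variety A ->
    forall x y y' : Con A, (commutator x y = commutator x y' ->
      commutator x y = commutator x (y + y'))%con).
  move=> /(_ G inG cx cy cy').
  have /commutator_eq0 -> := centralizes_xy0.
  have /commutator_eq0 -> := centralizes_xy'0.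
  by move=> /(_ erefl) /esym /commutator_eq0; apply: not_centralizes_xyy'0.
do !split; apply: (@not_Maltsev_definable _ Groupoids) => //.
- by move=> A _ x y; rewrite !Sets_commutator.
- move=> A _ x y z; rewrite !Sets_commutator.
  by apply: con_ext; [apply: con_le0 | apply/con_joinP; split=> ?].
(* The right-hand side is at most [cb]. The left-hand side contains ([vp], [vq]) because of [cw],
   and then ([vr], [vs]) because of [cx], a pair outside [cb]. *)
- move=> /(_ G inG cx cw cy) E.
  have := (commutator_least (con_join cx cw) cy).1; rewrite {}E.
  set d := con_join (commutator cx cy) _ => C.
  have db : con_le d cb.
    apply/con_joinP; split; last exact: (commutator_least cw cy).2 _ centralizes_wyb.
    have /commutator_eq0 -> := centralizes_xy0; exact: con_le0.
  suff /db : d vr vs by [].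
  apply: centralizes_xy_rs.
    by apply: centralizes_mono C => //; apply: con_le_joinl.
  apply: centralizes_wy_pq.
  by apply: centralizes_mono C => //; apply: con_le_joinr.
- move=> A _ x y z; rewrite !Sets_commutator.
  by apply: con_ext; [apply: con_le0 | apply/con_joinP; split=> ?].
(* Property (3) implies (4), as the join of two equal commutators adds nothing. *)
- move=> H; apply: n4 => A VA x y y' E; rewrite H // -E.
  by apply: con_ext; [apply: con_le_joinl | apply/con_joinP; split=> ?].
- by move=> A _ x y y'; rewrite !Sets_commutator.
- move=> A _ x.
  (* The intersection of the empty family is the full congruence. *)
  exists (con_inf (fun=> False)); split; first exact: Sets_commutator.
  by move=> z _ a b _ ? [].
- move=> A _ x z.
  exists (con_inf (fun=> False)); split; first exact: Sets_centralizes.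
  by move=> ? _ a b _ ? [].
- move=> H; apply: n5 => A VA x; have [y [C max]] := H A VA x con0.
  by exists y; split=> [|z]; [apply/commutator_eq0 | move/commutator_eq0; apply: max].
- by move=> A _ x y z; split=> _; apply: Sets_centralizes.
(* Under (7) the two commutators are intersections of the same family. *)
- move=> H; apply: n1 => A VA x y.
  by apply: con_ext => a b ab z /(H A VA); apply: ab.
- move=> A _ x y z; split=> _; last exact: Sets_centralizes.
  rewrite Sets_commutator; exact: con_le0.
- move=> H; apply: n9 => A VA x y z z' /(H A VA) le zz'.
  by apply/(H A VA) => a b /le /zz'.
- by move=> A _ x y z z' _ _; apply: Sets_centralizes.
- by move=> A _ x y z z' _ _ _; apply: Sets_centralizes.
Qed.
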